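(* Let $G$ be a finite group, let $I \leq G^{(\mathbb{N}^n)}$ be a shift-stable subgroup and let $B$ be a finite set of non-trivial tiles generating $I$ (i.e. $I=\langle B\rangle$). Fix a monomial order on $\mathbb{N}^n$. Then $B$ is a standard basis of $I$ if and only if every S-tile associated to $B$ has a trivial reduction by $B$.
   Context: $\mathbb{N}$ contains $0$. $G^{(\mathbb{N}^n)}$ is the group of finitely supported maps $f\colon\mathbb{N}^n\to G$ (''tiles'') under pointwise multiplication, where $\operatorname{supp}(f)=\{\alpha\mid f(\alpha)\ne e\}$; its neutral element is the trivial tile. For $\beta\in\mathbb{N}^n$, ${}^{\beta}f(\alpha)=f(\alpha-\beta)$ if $\alpha-\beta\in\mathbb{N}^n$ and $e$ otherwise. A subgroup $I$ is shift-stable if ${}^{\beta}f\in I$ for all $f\in I$, $\beta\in\mathbb{N}^n$. $\langle S\rangle$ is the smallest shift-stable subgroup containing $S$, i.e. the subgroup generated by all ${}^{\beta}s$, $\beta\in\mathbb{N}^n,s\in S$. $S^{\pm}=S\cup\{s^{-1}\mid s\in S\}$. A monomial order on $\mathbb{N}^n$ is a total order $<$ that is a well-order and satisfies $\alpha<\beta\Rightarrow\alpha+\gamma<\beta+\gamma$. For a non-trivial tile $f$, $\operatorname{multideg}(f)=\max_<\operatorname{supp}(f)$, and $\operatorname{LT}(f)$ is the tile with value $f(\operatorname{multideg}(f))$ at $\operatorname{multideg}(f)$ and $e$ elsewhere. Conventions: the leading term of the trivial tile is the trivial tile, and its multidegree is regarded as smaller than every element of $\mathbb{N}^n$. $\operatorname{LT}(I)=\{\operatorname{LT}(f)\mid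 f\in I\}$. A finite $B\subseteq I$ is a standard basis of $I$ if $\langle\operatorname{LT}(I)\rangle=\langle\operatorname{LT}(b):b\in B\rangle$. Reduction: a tile $r$ is a reduction of $f$ by $F$ if $f={}^{\alpha_1}f_1\cdots{}^{\alpha_m}f_m\cdot r$ for some $m\in\mathbb{N}$, $f_i\in F^{\pm}$, $\alpha_i\in\mathbb{N}^n$ such that $\operatorname{multideg}({}^{\alpha_i}f_i)\le\operatorname{multideg}(f)$ for all $i$, and $r$ is either trivial or $\operatorname{LT}(r)\notin\langle\operatorname{LT}(h):h\in F\rangle$. S-tiles: write $g^f=f^{-1}gf$, $[x,y]=\{x,\dots,y\}$ for integers $x\le y$, and $\|f\|=\min\{d\in\mathbb{N}\mid\operatorname{supp}(f)\subseteq[0,d]^n\}$. An S-tile associated to $B$ is a tile of the form $({}^{\alpha_1}b_1)^{f_1}\cdot({}^{\alpha_2}b_2)^{f_2}\cdots({}^{\alpha_m}b_m)^{f_m}$ with $m\in\mathbb{N}$, $b_i\in B^{\pm}$, $\alpha_i\in[0,\,2\max_{b\in B}\|b\|]^n$, and $f_i\in\langle B\rangle$. *)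

(* Defs.v *)
From HB Require Import structures.
From mathcomp Require Import all_boot fingroup finmap.
From mathcomp Require Import boolp classical_sets wochoice.
From mathcomp Require Import mpoly.

Set Implicit Arguments.
Unset Strict Implicit.
Unset Printing Implicit Defensive.

Local Open Scope classical_set_scope.
Local Open Scope group_scope.

(* Exponents, i.e. elements of N^n, are the multi-indices 'X_{1..n}; on them *)
(* (a + b)%MM, (a - b)%MM and (a <= b)%MM are componentwise, the subtraction *)
(* being truncated.                                                          *)

Definition tile (n : nat) (G : groupType) := {fsfun 'X_{1..n} -> G with 1}.

HB.instance Definition _ (n : nat) (G : groupType) :=
  Choice.on (tile n G).

Section TileGroup.
Context (n : nat) (G : groupType).
Implicit Types (f g h : tile n G) (a b : 'X_{1..n}).

Definition tile_one : tile n G := [fsfun with 1].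
Definition tile_mul f g : tile n G :=
  [fsfun a in (finsupp f `|` finsupp g)%fset => f a * g a | 1].
Definition tile_inv f : tile n G := [fsfun a in finsupp f => (f a)^-1 | 1].

Lemma tile_oneE a : tile_one a = 1.
Proof. by rewrite fsfunE. Qed.

Lemma tile_mulE f g a : tile_mul f g a = f a * g a.
Proof.
rewrite fsfunE in_fsetU; case: finsuppP => /= _; last by [].
by case: finsuppP => /= _; rewrite ?mulg1.
Qed.

Lemma tile_invE f a : tile_inv f a = (f a)^-1.
Proof. by rewrite fsfunE; case: finsuppP => //= _; rewrite invg1. Qed.

Fact tile_mulA : associative tile_mul.
Proof. by move=> f g h; apply/fsfunP => a; rewrite !tile_mulE mulgA. Qed.

Fact tile_mul1 : left_id tile_one tile_mul.
Proof. by move=> f; apply/fsfunP => a; rewrite tile_mulE tile_oneE mul1g. Qed.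

Fact tile_mulr1 : right_id tile_one tile_mul.
Proof. by move=> f; apply/fsfunP => a; rewrite tile_mulE tile_oneE mulg1. Qed.

Fact tile_mulV : left_inverse tile_one tile_inv tile_mul.
Proof.
by move=> f; apply/fsfunP => a; rewrite tile_mulE tile_invE tile_oneE mulVg.
Qed.

Fact tile_mulrV : right_inverse tile_one tile_inv tile_mul.
Proof.
by move=> f; apply/fsfunP => a; rewrite tile_mulE tile_invE tile_oneE mulgV.
Qed.

HB.instance Definition _ := isGroup.Build (tile n G)
  tile_mulA tile_mul1 tile_mulr1 tile_mulV tile_mulrV.

End TileGroup.

Section Shifts.
Context (n : nat) (G : groupType).
Implicit Types (f : tile n G) (a b : 'X_{1..n}) (I S : set (tile n G)).

Definition shift b f : tile n G :=
  [fsfun a in [fset (b + c)%MM | c in finsupp f]%fset => f (a - b)%MM | 1].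

Lemma shiftE b f a : shift b f a = if (b <= a)%MM then f (a - b)%MM else 1.
Proof.
rewrite fsfunE; case: imfsetP => /= [[c cf ->]|abf].
  by rewrite lem_addr // lem_refl.
case: ifP => // leba; apply/esym/fsfun_dflt/negP => abS.
by apply: abf; exists (a - b)%MM; rewrite // addmC submK.
Qed.

Definition shift_stable I := forall f b, I f -> I (shift b f).

Definition shift_subgroup I := group_closed (mem I) /\ shift_stable I.

Lemma shift_subgroupP I : shift_subgroup I <->
  [/\ I 1, forall f g, I f -> I g -> I (f * g), forall f, I f -> I f^-1 &
      forall f b, I f -> I (shift b f)].
Proof.
split=> [[cI sI]|[I1 IM IV sI]].
  split=> //; first by have /set_mem := cI.1.
  - move=> f g /mem_set If /mem_set Ig; apply/set_mem; exact: group_closedM.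
  - move=> f /mem_set If; apply/set_mem; exact: (group_closedV cI).
split=> //; split=> [|f g]; first exact/mem_set.
by move=> /set_mem If /set_mem Ig; apply/mem_set/IM => //; apply: IV.
Qed.

Definition shift_gen S : set (tile n G) := smallest shift_subgroup S.

Definition pm S := S `|` [set s^-1 | s in S].

End Shifts.

Section MonomialOrder.
Context (n : nat) (lt : rel 'X_{1..n}).

Definition mle : rel 'X_{1..n} := fun a b => (a == b) || lt a b.

Definition monomial_order :=
  [/\ irreflexive lt, total_order mle, well_order mle &
      forall a b c, lt a b -> lt (a + c)%MM (b + c)%MM].

(* None is the multidegree of the trivial tile. *)
Definition multideg_le (d e : option 'X_{1..n}) : bool :=
  match d, e with
  | None, _ => true
  | Some _, None => false
  | Some a, Some b => mle a b
  end.

Context (G : groupType).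
Implicit Types (f r : tile n G) (I F : set (tile n G)).

Definition multideg f : option 'X_{1..n} :=
  omap val [pick a : finsupp f | [forall b : finsupp f, mle (val b) (val a)]].

Definition LT f : tile n G :=
  if multideg f is Some a then [fsfun b in [fset a]%fset => f b | 1] else 1.

Definition standard_basis I (B : {fset tile n G}) :=
  [set` B] `<=` I /\
  shift_gen [set LT f | f in I] = shift_gen [set LT b | b in [set` B]].

Definition reduction F f r :=
  (exists (m : nat) (al : 'I_m -> 'X_{1..n}) (g : 'I_m -> tile n G),
     [/\ forall i, pm F (g i),
         forall i, multideg_le (multideg (shift (al i) (g i))) (multideg f) &
         f = (\prod_(i < m) shift (al i) (g i)) * r]) /\
  (r = 1 \/ ~ shift_gen [set LT h | h in F] (LT r)).

End MonomialOrder.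

Section STiles.
Context (n : nat) (G : groupType).
Implicit Types (f : tile n G) (B : {fset tile n G}).

Definition supp_in_cube f (d : nat) : bool :=
  [forall a : finsupp f, [forall j : 'I_n, val a j <= d]].

Lemma supp_in_cube_ex f : exists d, supp_in_cube f d.
Proof.
exists (\max_(a : finsupp f) \max_(j < n) val a j)%N.
apply/forallP => a; apply/forallP => j.
apply: leq_trans (leq_bigmax a); exact: (leq_bigmax j).
Qed.

Definition tile_norm f : nat := ex_minn (supp_in_cube_ex f).

Definition S_tile B f :=
  exists (m : nat) (al : 'I_m -> 'X_{1..n}) (b h : 'I_m -> tile n G),
    [/\ forall i, pm [set` B] (b i),
        forall i j, (al i j <= 2 * \max_(c <- B) tile_norm c)%N,
        forall i, shift_gen [set` B] (h i) &
        f = \prod_(i < m) shift (al i) (b i) ^ h i].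

End STiles.

(* Main.v *)
(* Forward direction: if f in I has multidegree c, LT(f) is a product of shifts of
   LT(b)^{+-1}, and only the factors located at c matter; the same product of
   shifts of b^{+-1} agrees with f at c, so dividing by it lowers the multidegree.

   Backward direction: write f in I as a product of shifts of letters in B^{+-1},
   and let c be the largest multidegree of a factor. If f(c) <> e, then f(c) is
   read off the factors of multidegree c. If f(c) = e, move those factors to the
   left by conjugation. With d = max ||b||, each of them has its support in
   c - d + N^n, hence a conjugating letter meeting that support is shifted by at
   least c - 2d in each coordinate, and the letters that do not meet it can be
   dropped. So the collected factors form a shift, by c - 2d (truncated), of an
   S-tile; its trivial reduction replaces them by factors of multidegree < c, and
   the well-order concludes. *)

Require Import Defs.
From mathcomp Require Import all_boot fingroup finmap zify.
From mathcomp Require Import boolp classical_sets.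
From mathcomp Require Import mpoly.

Set Implicit Arguments.
Unset Strict Implicit.
Unset Printing Implicit Defensive.

Local Open Scope group_scope.

(** * Pointwise formulas and shifts of tiles *)

Section Tiles.
Context (n : nat) (G : groupType).
Implicit Types (f g h : tile n G) (a b c d : 'X_{1..n}) (P Q : 'X_{1..n} -> Prop).

Lemma tile1E a : (1 : tile n G) a = 1.
Proof. exact: tile_oneE. Qed.

Lemma tileME f g a : (f * g) a = f a * g a.
Proof. exact: tile_mulE. Qed.

Lemma tileVE f a : f^-1 a = (f a)^-1.
Proof. exact: tile_invE. Qed.

Lemma tileJE f h a : (f ^ h) a = f a ^ h a.
Proof. by rewrite /conjg !tileME tileVE. Qed.

Lemma tile_neq1 f : f <> 1 -> exists a, f a != 1.
Proof.
move=> f1; apply: contrapT => /forallNP f0; apply: f1; apply/fsfunP => a.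
by rewrite tile1E; apply: contrapT => fa; apply: (f0 a); apply/eqP.
Qed.

Lemma lem_addl a b c : (a + b <= c)%MM = (a <= c)%MM && (b <= c - a)%MM.
Proof.
apply/mnm_lepP/andP => [le|[/mnm_lepP le1 /mnm_lepP le2] i].
  by split; apply/mnm_lepP => i; have := le i; rewrite !mnmE; lia.
by have := le1 i; have := le2 i; rewrite !mnmE; lia.
Qed.

Lemma shift1 b : shift b 1 = 1 :> tile n G.
Proof. by apply/fsfunP => a; rewrite shiftE !tile1E if_same. Qed.

Lemma shiftM b f g : shift b (f * g) = shift b f * shift b g.
Proof.
by apply/fsfunP => a; rewrite !(shiftE, tileME); case: ifP; rewrite ?mulg1.
Qed.

Lemma shiftV b f : shift b f^-1 = (shift b f)^-1.
Proof.
by apply/fsfunP => a; rewrite !(shiftE, tileVE); case: ifP; rewrite ?invg1.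
Qed.

Lemma shiftJ b f h : shift b (f ^ h) = shift b f ^ shift b h.
Proof. by rewrite /conjg !shiftM shiftV. Qed.

Lemma shiftD a b f : shift a (shift b f) = shift (a + b)%MM f.
Proof.
apply/fsfunP => c; rewrite !shiftE lem_addl.
by case: ifP => //= _; rewrite submDA.
Qed.

Lemma shift0 f : shift 0%MM f = f.
Proof.
apply/fsfunP => a; rewrite shiftE subm0.
by have -> : (0 <= a)%MM by apply/mnm_lepP => i; rewrite mnm0E.
Qed.

Lemma shift_addE b f a : shift b f (b + a)%MM = f a.
Proof. by rewrite shiftE lem_addr ?lem_refl // addmC addmK. Qed.

(** * Bounds on supports *)

Definition supported P f := forall a, f a != 1 -> P a.

Lemma supported1 P : supported P 1.
Proof. by move=> a; rewrite tile1E eqxx. Qed.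

Lemma supportedM P f g : supported P f -> supported P g -> supported P (f * g).
Proof.
move=> sf sg a; rewrite tileME; have [->|/sf //] := eqVneq (f a) 1.
by rewrite mul1g; apply: sg.
Qed.

Lemma supportedV P f : supported P f -> supported P f^-1.
Proof. by move=> sf a; rewrite tileVE eq_invg1; apply: sf. Qed.

Lemma supportedJ P f h : supported P f -> supported P (f ^ h).
Proof.
move=> sf a; rewrite tileJE; have [->|/sf //] := eqVneq (f a) 1.
by rewrite conj1g eqxx.
Qed.

Lemma sub_supported P Q f :
  (forall a, P a -> Q a) -> supported P f -> supported Q f.
Proof. by move=> PQ sf a /sf/PQ. Qed.

Lemma supported_shift P b f :
  supported P (shift b f) <-> supported (fun a => P (b + a)%MM) f.
Proof.
split=> sf a; first by move=> fa; apply: sf; rewrite shift_addE.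
rewrite shiftE; case: ifP; rewrite ?eqxx // => leba /sf.
by rewrite addmC submK.
Qed.

(** * Generated shift-stable subgroups *)

Lemma shift_gen_subgroup (S : set (tile n G)) : shift_subgroup (shift_gen S).
Proof.
apply/shift_subgroupP; split.
- by move=> J [/shift_subgroupP[]].
- move=> f g Sf Sg J JS; have /shift_subgroupP[_ JM _ _] := JS.1.
  by apply: JM; [apply: Sf|apply: Sg].
- move=> f Sf J JS; have /shift_subgroupP[_ _ JV _] := JS.1.
  by apply: JV; apply: Sf.
- move=> f b Sf J JS; have /shift_subgroupP[_ _ _ Js] := JS.1.
  by apply: Js; apply: Sf.
Qed.

Lemma sub_shift_gen (S : set (tile n G)) : (S `<=` shift_gen S)%classic.
Proof. exact: sub_gen_smallest. Qed.

Lemma shift_gen_sub (S J : set (tile n G)) :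
  shift_subgroup J -> (S `<=` J)%classic -> (shift_gen S `<=` J)%classic.
Proof. exact: smallest_sub. Qed.

Lemma sub_pm (S J : set (tile n G)) :
  shift_subgroup J -> (S `<=` J)%classic -> (pm S `<=` J)%classic.
Proof.
by move=> /shift_subgroupP[_ _ JV _] SJ f [/SJ //|[s /SJ Js <-]]; apply: JV.
Qed.

Lemma pmV (S : set (tile n G)) f : pm S f -> pm S f^-1.
Proof.
case=> [Sf|[s Ss <-]]; first by right; exists f.
by rewrite invgK; left.
Qed.

(** * Words in shifted letters *)

Definition eval (w : seq ('X_{1..n} * tile n G)) : tile n G :=
  \prod_(p <- w) shift p.1 p.2.

Lemma eval_cat v w : eval (v ++ w) = eval v * eval w.
Proof. exact: big_cat. Qed.

Definition word_over (S : set (tile n G)) P (w : seq ('X_{1..n} * tile n G)) :=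
  forall p, p \in w -> pm S p.2 /\ supported P (shift p.1 p.2).

Definition presented (S : set (tile n G)) P f :=
  exists2 w, word_over S P w & f = eval w.

Lemma word_over_cons S P p w : word_over S P (p :: w) <->
  [/\ pm S p.2, supported P (shift p.1 p.2) & word_over S P w].
Proof.
split=> [wP|[pmp sp wP] q].
  have [] := wP p (mem_head _ _); split=> // q qw.
  by apply: wP; rewrite inE qw orbT.
by rewrite inE => /predU1P[->//|/wP].
Qed.

Lemma presented1 S P : presented S P 1.
Proof. by exists [::]; rewrite /eval ?big_nil. Qed.

Lemma presentedM S P f g :
  presented S P f -> presented S P g -> presented S P (f * g).
Proof.
move=> [v vP ->] [w wP ->]; exists (v ++ w); last by rewrite eval_cat.
by move=> p; rewrite mem_cat => /orP[/vP|/wP].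
Qed.

Lemma presented_letter S P b s :
  pm S s -> supported P (shift b s) -> presented S P (shift b s).
Proof.
move=> Ss sP; exists [:: (b, s)]; last by rewrite /eval big_seq1.
by move=> p; rewrite inE => /eqP->.
Qed.

Lemma presented_sub S P (K : set (tile n G)) :
  K 1 -> (forall f g, K f -> K g -> K (f * g)) ->
  (forall b s, pm S s -> supported P (shift b s) -> K (shift b s)) ->
  (presented S P `<=` K)%classic.
Proof.
move=> K1 KM Ks f [w wP ->]; elim: w wP => [|p w IHw]; first by rewrite /eval big_nil.
case/word_over_cons => pmp sp /IHw Kw; rewrite /eval big_cons.
by apply: KM => //; apply: Ks.
Qed.

Lemma presentedV S P f : presented S P f -> presented S P f^-1.
Proof.
move: f; apply: presented_sub; first by rewrite invg1; apply: presented1.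
  by move=> f g Pf Pg; rewrite invMg; apply: presentedM.
move=> b s Ss sP; rewrite -shiftV; apply: presented_letter; first exact: pmV.
by rewrite shiftV; apply: supportedV.
Qed.

Lemma presented_supported S P f : presented S P f -> supported P f.
Proof.
move: f; apply: presented_sub => //; first exact: supported1.
by move=> f g; apply: supportedM.
Qed.

Lemma sub_presented S P Q f :
  (forall a, P a -> Q a) -> presented S P f -> presented S Q f.
Proof.
move=> PQ [w wP ->]; exists w => // p /wP[Sp sp]; split=> //.
exact: sub_supported sp.
Qed.

Lemma presented_shift S P Q b f : (forall a, P a -> Q (b + a)%MM) ->
  presented S P f -> presented S Q (shift b f).
Proof.
move=> PQ; move: f; apply: presented_sub.
- by rewrite shift1; apply: presented1.
- by move=> f g Qf Qg; rewrite shiftM; apply: presentedM.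
move=> c s Ss sP; rewrite shiftD; apply: presented_letter => //.
by rewrite -shiftD supported_shift; apply: sub_supported sP.
Qed.

Lemma presented_gen S P f : presented S P f -> shift_gen S f.
Proof.
have genS := shift_gen_subgroup S.
have /shift_subgroupP[g1 gM gV gs] := genS.
move: f; apply: presented_sub => // b s Ss _; apply: gs.
exact: sub_pm genS (@sub_shift_gen S) _ Ss.
Qed.

(** The tiles presented without a bound already form a shift-stable subgroup containing [S]. *)
Lemma gen_presented S : (shift_gen S `<=` presented S (fun=> True))%classic.
Proof.
apply: shift_gen_sub => [|s Ss].
  apply/shift_subgroupP; split.
  - exact: presented1.
  - by move=> *; apply: presentedM.
  - by move=> *; apply: presentedV.
  - by move=> ? b; apply: presented_shift.
by rewrite -(shift0 s); apply: presented_letter => //; left.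
Qed.

(** * Restriction to one exponent *)

(** At the multidegree this is the leading term; fixing the exponent makes it multiplicative, which
    [LT] is not. *)
Definition cut c f : tile n G := [fsfun a in [fset c]%fset => f a | 1].

Lemma cutE c f a : cut c f a = if a == c then f c else 1.
Proof. by rewrite fsfunE inE; case: eqP => // ->. Qed.

Lemma cut1 c : cut c 1 = 1.
Proof. by apply/fsfunP => a; rewrite cutE !tile1E if_same. Qed.

Lemma cutM c f g : cut c (f * g) = cut c f * cut c g.
Proof.
by apply/fsfunP => a; rewrite !(cutE, tileME); case: ifP; rewrite ?mulg1.
Qed.

Lemma cutV c f : cut c f^-1 = (cut c f)^-1.
Proof.
by apply/fsfunP => a; rewrite !(cutE, tileVE); case: ifP; rewrite ?invg1.
Qed.

Lemma cut_shift b c f : cut (b + c)%MM (shift b f) = shift b (cut c f).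
Proof.
apply/fsfunP => a; rewrite cutE shift_addE shiftE cutE.
case: eqP => [->|ac]; first by rewrite lem_addr ?lem_refl // addmC addmK eqxx.
case: ifP => // leba; case: eqP => // E; case: ac.
by rewrite -E addmC submK.
Qed.

Lemma cut_eq1 c f : f c = 1 -> cut c f = 1.
Proof.
by move=> fc; apply/fsfunP => a; rewrite cutE fc if_same tile1E.
Qed.

Lemma tile_norm_supp f a j : f a != 1 -> (a j <= tile_norm f)%N.
Proof.
rewrite /tile_norm; case: ex_minnP => d /forallP cf _ fa.
have af : a \in finsupp f by rewrite mem_finsupp.
by have /forallP/(_ j) := cf [` af]%fset.
Qed.

End Tiles.

(** * Monomial orders *)

Section MonomialOrders.
Context (n : nat) (lt : rel 'X_{1..n}) (ltP : monomial_order lt).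
Implicit Types (a b c : 'X_{1..n}).

Local Notation mle := (mle lt).

Lemma mle_refl a : mle a a.
Proof. by rewrite /Defs.mle eqxx. Qed.

Lemma ltW a b : lt a b -> mle a b.
Proof. by rewrite /Defs.mle orbC => ->. Qed.

Lemma mle_trans a b c : mle a b -> mle b c -> mle a c.
Proof. by have [_ [[[_ tr] _] _] _ _] := ltP; apply: tr. Qed.

Lemma mle_anti a b : mle a b -> mle b a -> a = b.
Proof. by have [_ [[_ anti] _] _ _] := ltP => ab ba; apply: anti; rewrite ab ba. Qed.

Lemma ltNle a b : lt a b = ~~ mle b a.
Proof.
have [irr [_ tot] _ _] := ltP; apply/idP/idP => [ab|].
  by apply/negP => /(mle_anti (ltW ab)) E; rewrite E irr in ab.
have /orP[/orP[/eqP->|//]|->//] := tot a b.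
by rewrite mle_refl.
Qed.

Lemma le_lt_trans a b c : mle a b -> lt b c -> lt a c.
Proof. by rewrite !ltNle => ab; apply: contra => ca; apply: mle_trans ab. Qed.

Lemma mle_add2l a b c : mle (c + a)%MM (c + b)%MM = mle a b.
Proof.
have add x y : mle x y -> mle (c + x)%MM (c + y)%MM.
  have [_ _ _ ltD] := ltP.
  case/orP => [/eqP->|xy]; first exact: mle_refl.
  by rewrite ![(c + _)%MM]addmC; apply/ltW/ltD.
apply/idP/idP => [|/add //]; apply: contraLR; rewrite -!ltNle => ba.
have [_ _ _ ltD] := ltP.
by rewrite ![(c + _)%MM]addmC; apply/ltD.
Qed.

(** A least counterexample, given by the well-order, would contradict the induction step. *)
Lemma lt_ind (K : 'X_{1..n} -> Prop) :
  (forall c, (forall a, lt a c -> K a) -> K c) -> forall c, K c.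
Proof.
move=> step c; apply: contrapT => nKc; have [_ _ wo _] := ltP.
have [|m [[/asboolP nKm mmin] _]] := wo (fun x => `[< ~ K x >]).
  by exists c; apply/asboolP.
apply: nKm; apply: step => a am; apply: contrapT => nKa.
by have := mmin a (asboolT nKa); apply/negP; rewrite -ltNle.
Qed.

Lemma seq_max (s : seq 'X_{1..n}) :
  s = [::] \/ exists2 c, c \in s & {in s, forall a, mle a c}.
Proof.
elim: s => [|b s [->|[c cs cmax]]]; [by left| |]; right.
  by exists b => [|a]; rewrite inE // => /eqP->; apply: mle_refl.
case: (boolP (mle b c)) => bc.
  exists c => [|a]; first by rewrite inE cs orbT.
  by rewrite inE => /predU1P[->|/cmax].
exists b => [|a]; first exact: mem_head.
rewrite -ltNle in bc.
rewrite inE => /predU1P[->|/cmax ac]; first exact: mle_refl.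
exact/(mle_trans ac)/ltW.
Qed.

(** * Leading terms and trivial reductions *)

Section LeadingTerms.
Context (G : groupType).
Implicit Types (f g r : tile n G) (S F : set (tile n G)).

Lemma multidegP f :
  if multideg lt f is Some c then f c != 1 /\ supported (mle^~ c) f else f = 1.
Proof.
rewrite /multideg; case: pickP => [c /forallP cmax|none] /=.
  split=> [|a fa]; first by rewrite -mem_finsupp; apply: valP.
  by rewrite -mem_finsupp in fa; have := cmax [` fa]%fset.
apply: contrapT => /tile_neq1[a fa].
have [s0|[c cf cmax]] := seq_max (finsupp f).
  by move: fa; rewrite -mem_finsupp -[a \in _]/(a \in (finsupp f : seq _)) s0.
have /forallP[] := none [` cf]%fset.
by move=> b; apply: cmax; apply: valP.
Qed.

Lemma LT_cut c f : f c != 1 -> supported (mle^~ c) f -> LT lt f = cut c f.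
Proof.
move=> fc fle; rewrite /LT; have := multidegP f.
case: (multideg lt f) => [d [fd dmax]|f1].
  by rewrite (mle_anti (fle d fd) (dmax c fc)).
by rewrite f1 tile1E eqxx in fc.
Qed.

(* [a] is at most the multidegree of [f]; never the case when [f] is trivial. *)
Definition dominated f : 'X_{1..n} -> Prop :=
  fun a => exists2 b, f b != 1 & mle a b.

Lemma multideg_leP f g :
  multideg_le lt (multideg lt g) (multideg lt f) <-> supported (dominated f) g.
Proof.
have := multidegP f; have := multidegP g.
case: (multideg lt g) => [c [gc cmax]|->]; last first.
  by move=> _; split=> // _; apply: supported1.
case: (multideg lt f) => [d [fd dmax]|->]; split=> //=.
- by move=> cd a /cmax ac; exists d => //; apply: mle_trans cd.
- by move=> /(_ c gc)[b /dmax bd cb]; apply: mle_trans bd.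
- by move=> /(_ c gc)[b]; rewrite tile1E eqxx.
Qed.

(** The remainder 1 meets the condition on [r] by its first alternative, so only the bounded word is
    left. *)
Lemma reductionP F f : reduction lt F f 1 <-> presented F (dominated f) f.
Proof.
split=> [[[m [al [g [gF gle fE]]]] _]|[w wF fE]].
  exists [seq (al i, g i) | i <- index_enum 'I_m].
    by move=> _ /mapP[i _ ->]; split; [apply: gF|apply/multideg_leP/gle].
  by rewrite {1}fE mulg1 /eval big_map.
split; last by left.
exists (size w), (fun i => (tnth (in_tuple w) i).1).
exists (fun i => (tnth (in_tuple w) i).2).
split=> [i|i|]; last by rewrite mulg1 {1}fE /eval big_tnth.
  by have [] := wF _ (mem_tnth i (in_tuple w)).
by apply/multideg_leP; have [] := wF _ (mem_tnth i (in_tuple w)).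
Qed.

(** The bound [c] is the largest exponent in the union of the supports of the factors; if this union
    is empty, every factor is trivial. *)
Lemma presented_top S P f : presented S P f ->
  f = 1 \/ exists2 c, P c & presented S (mle^~ c) f.
Proof.
move=> [w wS fE].
set s := flatten [seq (finsupp (shift p.1 p.2) : seq _) | p <- w].
have ws p a : p \in w -> shift p.1 p.2 a != 1 -> a \in s.
  move=> pw pa; apply/flatten_mapP; exists p => //.
  by rewrite -mem_finsupp in pa.
have [s0|[c /flatten_mapP[p pw pc] cmax]] := seq_max s; [left|right].
  apply: contrapT => /tile_neq1[a]; apply: (@presented_supported _ _ S (fun=> False)).
  exists w => // p pw; split=> [|b /(ws p b pw)]; last by rewrite s0.
  by have [] := wS p pw.
exists c; first by have [_] := wS p pw; apply; rewrite -mem_finsupp.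
exists w => // q qw; split=> [|b /(ws q b qw)/cmax //].
by have [] := wS q qw.
Qed.

(** The tiles that can be lifted at every exponent form a subgroup, and quantifying over all [c]
    makes it shift-stable. A leading term is lifted by its own tile at the multidegree and by 1
    elsewhere. *)
Lemma lift_leading S x c : shift_gen [set LT lt s | s in S]%classic x ->
  exists2 g, presented S (mle^~ c) g & g c = x c.
Proof.
move=> Sx; move: x Sx c.
suff : (shift_gen [set LT lt s | s in S] `<=`
  [set x | forall c, exists2 g, presented S (mle^~ c) g & g c = x c])%classic by [].
apply: shift_gen_sub => [|_ [s Ss <-] c].
  apply/shift_subgroupP; split=> [c|x y Kx Ky c|x Kx c|x b Kx c] /=.
  - by exists 1 => //; apply: presented1.
  - have [g Sg gx] := Kx c; have [h Sh hy] := Ky c.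
    by exists (g * h); rewrite ?tileME ?gx ?hy //; apply: presentedM.
  - have [g Sg gx] := Kx c.
    by exists g^-1; rewrite ?tileVE ?gx //; apply: presentedV.
  - case: (boolP (b <= c)%MM) => bc; last first.
      by exists 1; rewrite ?shiftE ?(negPf bc) ?tile1E //; apply: presented1.
    have [g Sg gx] := Kx (c - b)%MM.
    exists (shift b g); last by rewrite !shiftE bc.
    apply: presented_shift Sg => a; rewrite -(mle_add2l _ _ b).
    by rewrite [(b + (c - b))%MM]addmC submK.
have := multidegP s; rewrite /LT.
case: (multideg lt s) => [d [_ dmax]|_].
  rewrite -/(cut d s); case: (eqVneq c d) => [->|cd].
    exists s; last by rewrite cutE eqxx.
    rewrite -(shift0 s); apply: presented_letter; first by left.
    by rewrite shift0.
  by exists 1; rewrite ?cutE ?(negPf cd) ?tile1E //; apply: presented1.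
by exists 1 => //; apply: presented1.
Qed.

(** Cutting at [c] is multiplicative, and a factor bounded by [c] is cut either to 1 or to a shift
    of the leading term of an element of [S] or of its inverse. *)
Lemma cut_leading S c f : presented S (mle^~ c) f ->
  shift_gen [set LT lt s | s in S]%classic (cut c f).
Proof.
have /shift_subgroupP[g1 gM gV gs] := shift_gen_subgroup [set LT lt s | s in S]%classic.
move: f; apply: presented_sub => [|f g Kf Kg|b s Ss sle] /=.
- by rewrite cut1.
- by rewrite cutM; apply: gM.
have [sc|] := eqVneq (shift b s c) 1; first by rewrite cut_eq1.
rewrite shiftE; case: ifP; rewrite ?eqxx // => bc sc.
move: sle; rewrite -(submK bc) addmC; set d := (c - b)%MM in sc *.
rewrite supported_shift cut_shift => sle; apply: gs.
have {}sle : supported (mle^~ d) s by move=> a /sle; rewrite mle_add2l.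
case: Ss sc sle => [Ss|[t St <-]] sc sle.
  by apply: sub_shift_gen; exists s => //; apply: LT_cut.
rewrite cutV; apply: gV; apply: sub_shift_gen; exists t => //.
apply: LT_cut; first by rewrite -eq_invg1 -tileVE.
by rewrite -[t]invgK; apply: supportedV.
Qed.

End LeadingTerms.
End MonomialOrders.

(** * From a standard basis to trivial reductions *)

Section Criterion.
Context (n : nat) (G : groupType) (lt : rel 'X_{1..n}).
Context (ltP : monomial_order lt) (B : {fset tile n G}).
Implicit Types (f : tile n G) (a b c : 'X_{1..n}).
Implicit Type (T : seq ('X_{1..n} * tile n G * tile n G)).

Local Notation mle := (mle lt).
Local Notation BS := [set` B]%classic.
Definition max_norm : nat := \max_(b <- B) tile_norm b.

Local Notation d := max_norm.

(** Well-founded induction on [c], which is only an upper bound for the support, so that a tile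
    trivial at [c] can pass to its own multidegree. *)
Lemma standard_basis_presented c f :
  standard_basis lt (shift_gen BS) B -> shift_gen BS f ->
  supported (mle^~ c) f -> presented BS (dominated lt f) f.
Proof.
case=> _ LTE; have /shift_subgroupP[_ gM gV _] := shift_gen_subgroup BS.
elim/(lt_ind ltP): c f => c IHc f Bf fle.
have [fc|fc] := eqVneq (f c) 1.
  have := multidegP ltP f; case: (multideg lt f) => [a [fa fmax]|->]; last first.
    exact: presented1.
  apply: (IHc a) => //; case/orP: (fle a fa) => // /eqP E.
  by rewrite E fc eqxx in fa.
have LTf : shift_gen [set LT lt b | b in BS]%classic (cut c f).
  rewrite -LTE -(LT_cut ltP fc fle); apply: sub_shift_gen; by exists f.
have [g Bg] := lift_leading ltP c LTf; rewrite cutE eqxx => gc.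
(* Splitting off [g], which agrees with [f] at [c], leaves a remainder that is trivial or of smaller
   multidegree. *)
rewrite -{2}[f](mulKVg g); set r := g^-1 * f.
have rc : r c = 1 by rewrite tileME tileVE gc mulVg.
have rle : supported (mle^~ c) r.
  by apply: supportedM => //; apply: supportedV (presented_supported Bg).
apply: presentedM; first by apply: sub_presented Bg => a ac; exists c.
have Br : shift_gen BS r by apply: gM => //; apply: gV; apply: presented_gen Bg.
have := multidegP ltP r; case: (multideg lt r) => [e [re rmax]|->]; last first.
  exact: presented1.
have ec : lt e c.
  by case/orP: (rle e re) => // /eqP E; rewrite E rc eqxx in re.
apply: sub_presented (IHc e ec r Br rmax) => a [x /rle xc ax].
by exists c => //; apply: (mle_trans ltP) xc.
Qed.

(** * Collecting an S-tile from a word *)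

Lemma pm_norm (s : tile n G) a (j : 'I_n) :
  pm BS s -> s a != 1 -> (a j <= d)%N.
Proof.
move=> Bs sa; have {Bs sa}[b bB ba] : exists2 b, b \in B & b a != 1.
  case: Bs sa => [Bs|[b Bb <-]]; first by exists s.
  by rewrite tileVE eq_invg1; exists b.
apply: leq_trans (tile_norm_supp j ba) _.
by rewrite /max_norm (big_fsetD1 b) //= leq_maxl.
Qed.

Definition conj_prod T : tile n G :=
  \prod_(t <- T) shift t.1.1 t.1.2 ^ t.2.

Lemma S_tile_conj_prod T :
  (forall t, t \in T -> [/\ pm BS t.1.2, forall j, (t.1.1 j <= 2 * d)%N &
    shift_gen BS t.2]) -> S_tile B (conj_prod T).
Proof.
move=> TP; pose t i := tnth (in_tuple T) i.
have tP i := TP _ (mem_tnth i (in_tuple T)).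
exists (size T), (fun i => (t i).1.1), (fun i => (t i).1.2), (fun i => (t i).2).
split=> [i|i|i|]; last exact: big_tnth.
- by have [] := tP i.
- by have [] := tP i.
- by have [] := tP i.
Qed.

(** Induction on the word: a front letter that is nontrivial at [c] joins the S-tile, any other one
    is moved to its right. *)
Lemma presented_S_tile c w : word_over BS (mle^~ c) w ->
  let b := [multinom (c j - 2 * d)%N | j < n] in
  exists s f, [/\ S_tile B s, supported (mle^~ c) (shift b s),
    presented BS (lt^~ c) f & eval w = shift b s * f].
Proof.
move=> wB b.
have bE j : b j = (c j - 2 * d)%N by rewrite mnmE.
(* The added bound [c j <= b j + t.1.1 j + d] says that each collected factor has its support in c -
   d + N^n; it decides which letters can meet that factor. *)
suff [T [f [TP Tc fP wE]]] : exists T f, [/\ forall t, t \in T ->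
    [/\ pm BS t.1.2, forall j, (t.1.1 j <= 2 * d)%N, shift_gen BS t.2 &
        forall j, (c j <= b j + t.1.1 j + d)%N],
    supported (mle^~ c) (shift b (conj_prod T)),
    presented BS (lt^~ c) f & eval w = shift b (conj_prod T) * f].
  exists (conj_prod T), f; split=> //; apply: S_tile_conj_prod => t /TP[]; by split.
have /shift_subgroupP[g1 gM gV gs] := shift_gen_subgroup BS.
have gB x : pm BS x -> shift_gen BS x.
  exact: (sub_pm (shift_gen_subgroup BS) (@sub_shift_gen _ _ BS)).
elim: w wB => [|[a s] w IHw].
  exists [::], 1; split=> //.
  - by rewrite /conj_prod big_nil shift1; apply: supported1.
  - exact: presented1.
  - by rewrite /conj_prod /eval !big_nil shift1 mulg1.
case/word_over_cons => /= Bs sle /IHw[T [f [TP Tc fP wE]]].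
have -> : eval ((a, s) :: w) = shift a s * (shift b (conj_prod T) * f).
  by rewrite -wE /eval big_cons.
have [ac|ac] := eqVneq (shift a s c) 1; last first.
  (* Such a letter satisfies c - d <= a <= c, whence b <= a and a - b <= 2d; it is collected with
     trivial conjugator. *)
  have [leac sc] : (a <= c)%MM /\ s (c - a)%MM != 1.
    by move: ac; rewrite shiftE; case: ifP; rewrite ?eqxx.
  have car j : (c j <= a j + d)%N.
    by have := pm_norm j Bs sc; rewrite mnmBE; lia.
  have leba : (b <= a)%MM by apply/mnm_lepP => j; rewrite bE; have := car j; lia.
  have consE : shift b (conj_prod ((a - b, s, 1)%MM :: T)) =
               shift a s * shift b (conj_prod T).
    by rewrite /conj_prod big_cons conjg1 shiftM shiftD addmC submK.
  exists ((a - b, s, 1)%MM :: T), f; split=> //.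
  - move=> t; rewrite inE => /predU1P[->/=|/TP //]; split=> // j.
      move/mnm_lepP/(_ j): leac; rewrite mnmBE bE; lia.
    move/mnm_lepP/(_ j): leba; have := car j; rewrite mnmBE; lia.
  - by rewrite consE; apply: supportedM.
  - by rewrite consE mulgA.
(* Moving the letter to the right conjugates every collected factor by its inverse. The conjugator
   has to be a shift by [b], which needs b <= a; otherwise the letter is dropped. *)
pose F (t : 'X_{1..n} * tile n G * tile n G) :=
  (t.1, if (b <= a)%MM then t.2 * (shift (a - b)%MM s)^-1 else t.2).
have FE : shift b (conj_prod (map F T)) = shift b (conj_prod T) ^ (shift a s)^-1.
  rewrite /conj_prod big_map !(big_morph _ (shiftM b) (shift1 _ b)).
  rewrite (big_morph (conjg^~ _) (fun x y => conjMg x y _) (conj1g _)).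
  apply: eq_big_seq => t /TP[Bt _ _ tc]; rewrite /F /= !shiftJ -conjgM shiftD.
  case: ifP => [leba|nba].
    by rewrite shiftM shiftV shiftD [(b + (a - b))%MM]addmC submK.
  (* Here b_j > 0, so b_j = c_j - 2d without truncation: the letter stays within a_j + d < c_j - d
     in this coordinate, the factor at or above c_j - d. *)
  have [j ltab] : exists j, (a j < b j)%N.
    apply: contrapT => /forallNP nab; move/negP: nba; apply.
    by apply/mnm_lepP => j; rewrite leqNgt; apply/negP.
  (* The letter and the conjugated factor have disjoint supports. *)
  apply/fsfunP => x; rewrite !tileJE tileME tileVE.
  have [->|yx] := eqVneq (shift (b + t.1.1) t.1.2 x) 1; first by rewrite !conj1g.
  have [->|ax] := eqVneq (shift a s x) 1; first by rewrite invg1 mulg1.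
  exfalso; move: yx ax; rewrite !shiftE.
  case: ifP; rewrite ?eqxx // => /mnm_lepP/(_ j) lex _.
  case: ifP; rewrite ?eqxx // => _ /(pm_norm j Bs).
  by move: lex (tc j) ltab; rewrite !mnmE; lia.
exists (map F T), (shift a s * f); split.
- move=> _ /mapP[t /TP[Bt td tg tc] ->]; split=> //=; case: ifP => // _.
  exact: gM tg (gV _ (gs _ _ (gB _ Bs))).
- by rewrite FE; exact: supportedJ Tc.
- apply: presentedM => //; apply: presented_letter => // x xP.
  have := sle x xP; case/orP => // /eqP xc.
  by rewrite xc ac eqxx in xP.
- by rewrite FE /conjg invgK !mulgA mulgKV.
Qed.

(** * From trivial reductions to a standard basis *)

Context (redP : forall f, S_tile B f -> reduction lt BS f 1).

(** The factors outside the S-tile are below [c], so the shifted S-tile is trivial at [c] as well;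
    the factors of its trivial reduction are bounded by its multidegree, hence fall below [c] after
    the shift. *)
Lemma presented_lower c f :
  f c = 1 -> presented BS (mle^~ c) f -> presented BS (lt^~ c) f.
Proof.
move=> fc [w wB fE]; have [s [g [Bs sle gP wE]]] := presented_S_tile wB.
rewrite {}wE in fE; set b := [multinom _ | j < n] in sle fE.
have gc : g c = 1.
  apply/eqP; apply: contrapT => /negP /(presented_supported gP).
  by have [-> _ _ _] := ltP.
have sc : shift b s c = 1 by move: fc; rewrite fE tileME gc mulg1.
rewrite fE; apply: presentedM => //.
have /(reductionP ltP) := redP Bs; apply: presented_shift => a [x sx ax].
apply: (le_lt_trans ltP (b := (b + x)%MM)); first by rewrite mle_add2l.
have bx : shift b s (b + x)%MM != 1 by rewrite shift_addE.
case/orP: (sle _ bx) => // /eqP E.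
by rewrite E sc eqxx in bx.
Qed.

(** The top of a presentation is lowered until [f] is trivial or nontrivial at the top, which is
    then its multidegree; the well-order ensures that this stops. *)
Lemma reduction_presented f : shift_gen BS f -> presented BS (dominated lt f) f.
Proof.
move/gen_presented/(presented_top ltP) => [->|[c _]]; first exact: presented1.
elim/(lt_ind ltP): c f => c IHc f fB.
have [fc|fc] := eqVneq (f c) 1.
  have [->|[a /IHc]] := presented_top ltP (presented_lower fc fB).
    exact: presented1.
  by apply.
by apply: sub_presented fB => a ac; exists c.
Qed.

Lemma reduction_standard_basis : standard_basis lt (shift_gen BS) B.
Proof.
split; first exact: sub_shift_gen.
apply/seteqP; split; apply: shift_gen_sub => //.
- exact: shift_gen_subgroup.
- move=> _ [f Bf <-].
  have := reduction_presented Bf; have := multidegP ltP f; rewrite /LT.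
  case: (multideg lt f) => [c [fc fmax]|f1 _]; last first.
    by have /shift_subgroupP[] :=
      shift_gen_subgroup [set LT lt b | b in BS]%classic.
  (* Being dominated by [f] means lying below its multidegree [c], where the cut is the leading
     term. *)
  move=> fP; apply: (cut_leading ltP); apply: sub_presented fP => a [x /fmax xc ax].
  exact: (mle_trans ltP) xc.
- exact: shift_gen_subgroup.
- by move=> _ [b Bb <-]; apply: sub_shift_gen; exists b => //; apply: sub_shift_gen.
Qed.

End Criterion.

(** * Equivalence of the two conditions *)

Theorem theorem3p8 (n : nat) (G : finGroupType) (lt : rel 'X_{1..n})
    (I : set (tile n G)) (B : {fset tile n G}) :
  monomial_order lt ->
  shift_subgroup I ->
  1%g \notin B ->
  I = shift_gen [set` B]%classic ->
  standard_basis lt I B <->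
  (forall f : tile n G, S_tile B f -> reduction lt [set` B]%classic f 1%g).
Proof.
move=> ltP _ _ ->; split=> [sB f [m [al [b [h [Bb _ Bh fE]]]]]|]; last first.
  exact: reduction_standard_basis.
apply/(reductionP ltP).
(* An S-tile is a product of conjugates of elements of the subgroup by elements of it. *)
have Bf : shift_gen [set` B]%classic f.
  have genB := shift_gen_subgroup [set` B]%classic.
  have /shift_subgroupP[g1 gM gV gs] := genB.
  rewrite fE; apply: big_ind => // i _; apply: (gM) => //; first exact: gV.
  apply: (gM) => //; apply: (gs).
  exact: sub_pm genB (@sub_shift_gen _ _ _) _ (Bb i).
have := multidegP ltP f; case: (multideg lt f) => [c [_]|->].
  exact: standard_basis_presented.
exact: presented1.
Qed.
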